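(* There is a sequence of pairs of matrices $M_n, N_n\in\mathrm{Mat}_n(\mathbb{Z})$ ($n\ge 1$), where for each $n$ the matrices $M_n$ and $N_n$ are similar over $\mathbb{Z}_p$ for all primes $p$, such that \[\lim_{n\to\infty}C_{\mathbb{Q}}(M_n,N_n)=\infty.\]
   Context: For a commutative ring $R$, two matrices $M,N\in\mathrm{Mat}_n(R)$ are called similar over $R$ if there exists $U\in\mathrm{GL}_n(R)$ with $UM=NU$. For a number field $K$, $\mathcal{O}_K$ denotes its ring of integers. For $M,N\in\mathrm{Mat}_n(\mathcal{O}_K)$ that are similar over the completion $\mathcal{O}_{K_{\mathfrak{p}}}$ for every finite place $\mathfrak{p}$ of $K$, define \[C_K(M,N):=\min\{[L:K] : L/K \text{ is a finite extension such that } M,N \text{ are similar over } \mathcal{O}_L\}\] (such an $L$ exists by a theorem of Guralnick). *)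

(* Defs.v *)
From HB Require Import structures.
From mathcomp Require Import all_boot all_order all_algebra all_field.
From mathcomp Require Import boolp classical_sets functions filter.

Set Implicit Arguments.
Unset Strict Implicit.
Unset Printing Implicit Defensive.

Import GRing.Theory.
Local Open Scope classical_set_scope.
Local Open Scope ring_scope.

Definition similar_over (R : comNzRingType) (n : nat) (M N : 'M[R]_n) : Prop :=
  exists U V : 'M[R]_n,
    [/\ U *m V = 1%:M, V *m U = 1%:M & U *m M = N *m U].

Definition int_mx (R : comNzRingType) (n : nat) (M : 'M[int]_n) : 'M[R]_n :=
  map_mx intr M.

(* p-adic integers: Z_p is the inverse limit of the rings Z/p^(k+1), k >= 0, as
   a subring of their product. The exponent starts at 1 because 'Z_1 is Z/2. *)
Definition residues (p : nat) : Type := forall k : nat, 'Z_(p ^ k.+1).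

Section Residues.
Variable p : nat.
Implicit Types x y z : residues p.

HB.instance Definition _ := gen_eqMixin (residues p).
HB.instance Definition _ := gen_choiceMixin (residues p).

Definition res_zero : residues p := fun _ => 0.
Definition res_one : residues p := fun _ => 1.
Definition res_opp x : residues p := fun k => - x k.
Definition res_add x y : residues p := fun k => x k + y k.
Definition res_mul x y : residues p := fun k => x k * y k.

Fact res_addA : associative res_add.
Proof. by move=> x y z; apply: functional_extensionality_dep => k; apply: addrA. Qed.
Fact res_addC : commutative res_add.
Proof. by move=> x y; apply: functional_extensionality_dep => k; apply: addrC. Qed.
Fact res_add0 : left_id res_zero res_add.
Proof. by move=> x; apply: functional_extensionality_dep => k; apply: add0r. Qed.
Fact res_addN : left_inverse res_zero res_opp res_add.
Proof. by move=> x; apply: functional_extensionality_dep => k; apply: addNr. Qed.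

HB.instance Definition _ :=
  GRing.isZmodule.Build (residues p) res_addA res_addC res_add0 res_addN.

Fact res_mulA : associative res_mul.
Proof. by move=> x y z; apply: functional_extensionality_dep => k; apply: mulrA. Qed.
Fact res_mulC : commutative res_mul.
Proof. by move=> x y; apply: functional_extensionality_dep => k; apply: mulrC. Qed.
Fact res_mul1 : left_id res_one res_mul.
Proof. by move=> x; apply: functional_extensionality_dep => k; apply: mul1r. Qed.
Fact res_mulDl : left_distributive res_mul +%R.
Proof. by move=> x y z; apply: functional_extensionality_dep => k; apply: mulrDl. Qed.
Fact res_one_neq0 : res_one != 0.
Proof.
by apply/eqP => /(congr1 (fun x : residues p => x 0)) /eqP; apply/negP/oner_neq0.
Qed.

HB.instance Definition _ := GRing.Zmodule_isComNzRing.Build (residues p)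
  res_mulA res_mulC res_mul1 res_mulDl res_one_neq0.

Definition coherent : {pred residues p} :=
  fun x => `[< forall k : nat, inZp (x k.+1) = x k >].

Fact Zp_trunc_dvd (k : nat) :
  ((Zp_trunc (p ^ k.+1)).+2 %| (Zp_trunc (p ^ k.+2)).+2)%N.
Proof.
case: p => [|[|q]]; rewrite ?exp1n ?exp0n //.
by rewrite !Zp_cast ?(ltn_exp2l 0) // (expnSr _ k.+1) dvdn_mulr.
Qed.

Fact coherent_subring_closed : subring_closed coherent.
Proof.
have redD k (a b : 'Z_(p ^ k.+2)) :
    inZp (a + b)%R = inZp a + inZp b :> 'Z_(p ^ k.+1).
  by apply: val_inj; rewrite /= modn_dvdm ?Zp_trunc_dvd // modnDm.
split=> [|x y /asboolP cx /asboolP cy|x y /asboolP cx /asboolP cy];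
  apply/asboolP => k.
- by apply: val_inj; rewrite /= modn_dvdm ?Zp_trunc_dvd.
- apply: (addIr (y k)); rewrite -[in LHS]cy -redD.
  have -> : (x - y) k.+1 + y k.+1 = x k.+1 by apply: subrK.
  by rewrite cx; symmetry; apply: subrK.
- have -> : (x * y) k = x k * y k by [].
  by rewrite -cx -cy; apply: val_inj; rewrite /= modn_dvdm ?Zp_trunc_dvd // modnMm.
Qed.

HB.instance Definition _ :=
  GRing.isSubringClosed.Build (residues p) coherent coherent_subring_closed.

Record padic_int := PadicInt {
  padic_residues : residues p;
  _ : padic_residues \in coherent }.

HB.instance Definition _ := [isSub for padic_residues].
HB.instance Definition _ := [Choice of padic_int by <:].
HB.instance Definition _ := [SubChoice_isSubComNzRing of padic_int by <:].

End Residues.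

Section RingOfIntegers.
Variable K : fieldType.

Definition algint : {pred K} :=
  fun x => `[< integralOver (intr : int -> K) x >].

Fact algint_subring_closed : subring_closed algint.
Proof.
split=> [|x y /asboolP ix /asboolP iy|x y /asboolP ix /asboolP iy];
  apply/asboolP.
- exact: integral1.
- exact: integral_sub.
- exact: integral_mul.
Qed.

HB.instance Definition _ :=
  GRing.isSubringClosed.Build K algint algint_subring_closed.

Record ring_of_integers := RingOfIntegers {
  roi_val : K;
  _ : roi_val \in algint }.

HB.instance Definition _ := [isSub for roi_val].
HB.instance Definition _ := [Choice of ring_of_integers by <:].
HB.instance Definition _ := [SubChoice_isSubComNzRing of ring_of_integers by <:].

End RingOfIntegers.

Section Extension.
Variables (K : fieldType) (L : fieldExtType K).

Fact algint_in_alg (x : ring_of_integers K) : (\val x)%:A \in @algint L.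
Proof.
case: x => x /= /asboolP ix; apply/asboolP.
suff -> : (intr : int -> L) = in_alg L \o intr by apply: integral_rmorph ix.
by apply: functional_extensionality_dep => z; rewrite -(rmorph_int (in_alg L)).
Qed.

Definition roi_ext (x : ring_of_integers K) : ring_of_integers L :=
  RingOfIntegers (algint_in_alg x).

End Extension.

(* For a number field [K]. An [L : fieldExtType K] is a finite extension of [K],
   of degree [\dim {:L}]. *)
Definition similarity_degrees (K : fieldType) (n : nat)
    (M N : 'M[ring_of_integers K]_n) : set nat :=
  [set d | exists L : fieldExtType K,
     \dim {:L} = d /\
     similar_over (map_mx (@roi_ext K L) M) (map_mx (@roi_ext K L) N)].

(* The minimum of [similarity_degrees M N], and 0 (never a degree) if this set
   is empty. *)
Definition min_similarity_degree (K : fieldType) (n : nat)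
    (M N : 'M[ring_of_integers K]_n) : nat :=
  xget 0%N [set d | similarity_degrees M N d /\
                    forall e, similarity_degrees M N e -> (d <= e)%N].

(* Main.v *)
Require Import Defs.
From mathcomp Require Import all_boot all_order all_algebra all_field.
From mathcomp Require Import boolp classical_sets functions filter.
From mathcomp Require Import ring zify.

(** For integers [u <> 0] and [d > 1], the [2 x 2] matrices [M = (0 1; 0 d)] and
    [N = (0 u; 0 d)] define modules over [Z[x]/(x (x - d))], a fibre product of
    two copies of [Z] over [Z/d]. Their similarity over a ring [R] without
    [Z]-torsion comes down to one question: is there a unit [e] of [R] with
    [e = u] modulo [d R]? ([class_mx_similar], [class_mx_similar_inv].) An
    identity block, whose eigenvalue [1] is neither [0] nor [d], brings the
    matrices to any size at least two without changing the question. The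
    matrices of size [n] are those for [u = 2] and [d = 2 ^ n + 1].

    Over the [p]-adic integers such a unit always exists, because [u] and [d]
    are coprime: if [p] is odd, [2] is itself a unit; if [p = 2], then [d] is
    invertible and [1 = 2] modulo [d].

    Over the integers of a number field [L], let [e = u - d x] be a unit with
    [x] integral. If [P] is the minimal polynomial of [x], of degree [m], then
    [d ^ m * P(u / d)] is, up to sign, the norm of [e] from [Q(x)] to [Q], so it
    is [1] or [- 1]; but it is also [u ^ m] modulo [d]. Hence [d] divides
    [u ^ m - 1] or [u ^ m + 1] for some [m] with [0 < m <= [L : Q]]
    ([unit_congruence_bound]). For [u = 2] and [d = 2 ^ n + 1] this forces
    [n <= m], so that the degree of [L] is at least [n].

    A suitable [L] does exist. As [d] divides [u ^ n + 1], Bezout's identity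
    gives integers [a], [b] such that [u - d x] is a unit for each root [x] of
    [X ^ n + a X ^ (n - 1) + b] ([class_mx_similar_number_field]). The minimal
    degree is therefore attained, and it is at least [n]. *)

Set Implicit Arguments.
Unset Strict Implicit.
Unset Printing Implicit Defensive.

Import Order.TTheory GRing.Theory Num.Theory.
Local Open Scope classical_set_scope.
Local Open Scope ring_scope.

(** * Units of number fields congruent to an integer *)

(** The homogenization of [q], of degree [(size q).-1], evaluated at [(u, d)]:
    the integer [d ^ deg q * q(u / d)]. *)
Definition homog_eval (u d : int) (q : {poly int}) : int :=
  \sum_(i < size q) q`_i * u ^+ i * d ^+ ((size q).-1 - i).

Lemma homog_evalE (u d : int) (q : {poly int}) : d != 0 ->
  (homog_eval u d q)%:~R
    = d%:~R ^+ (size q).-1 * (map_poly intr q).[u%:~R / d%:~R] :> rat.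
Proof.
move=> d0; have d0q : d%:~R != 0 :> rat by rewrite intr_eq0.
rewrite horner_coef size_map_inj_poly //; last exact: intr_inj.
rewrite rmorph_sum mulr_sumr /=; apply: eq_bigr => i _.
rewrite coef_map /= !rmorphM !rmorphXn /= expr_div_n.
have le_i : (i <= (size q).-1)%N by rewrite -ltnS (ltn_predK (ltn_ord i)).
rewrite -[in X in _ = X * _](subnK le_i) exprD.
field.
by rewrite expf_neq0.
Qed.

Lemma homog_eval_monic (u d : int) (q : {poly int}) : q \is monic ->
  (d %| homog_eval u d q - u ^+ (size q).-1)%Z.
Proof.
move=> mq; rewrite /homog_eval.
have : (0 < size q)%N by rewrite size_poly_gt0 monic_neq0.
have := monicP mq; rewrite lead_coefE.
case: (size q) => // m /= qm _.
rewrite big_ord_recr /= subnn expr0 mulr1 qm mul1r addrK.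
elim/big_rec: _ => [|i x _ dx]; first exact: dvdz0.
rewrite rpredD //.
apply: dvdz_mull; rewrite -(subnSK (ltn_ord i)) exprS.
by apply: dvdz_mulr.
Qed.

(** The reversed polynomial [X ^ deg q * q(1 / X)]. *)
Definition reverse_poly (R : nzRingType) (q : {poly R}) : {poly R} :=
  \poly_(i < size q) q`_((size q).-1 - i).

Lemma reverse_poly0 (R : nzRingType) (q : {poly R}) :
  (reverse_poly q).[0] = lead_coef q.
Proof.
rewrite horner_coef0 coef_poly lead_coefE subn0 size_poly_gt0.
by case: eqP => // ->; rewrite coef0.
Qed.

Lemma reverse_poly_root (R : comNzRingType) (q : {poly int}) (x y : R) :
  x * y = 1 -> (map_poly intr q).[y] = 0 ->
  (map_poly intr (reverse_poly q)).[x] = 0.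
Proof.
move=> xy1 qy0.
have -> : (map_poly intr (reverse_poly q)).[x]
    = x ^+ (size q).-1 * (map_poly intr q).[y].
  rewrite (@horner_coef_wide _ (size q)); last first.
    by rewrite (leq_trans (size_poly _ _)) // size_poly.
  rewrite (@horner_coef_wide _ (size q) (map_poly intr q)) ?size_poly //.
  rewrite mulr_sumr (reindex_inj rev_ord_inj) /=; apply: eq_bigr => i _.
  have le_i : (i <= (size q).-1)%N by rewrite -ltnS (ltn_predK (ltn_ord i)).
  rewrite !coef_map_id0 // coef_poly.
  rewrite rev_ord_proof.
  have -> : (size q - i.+1 = (size q).-1 - i)%N by lia.
  rewrite subKn // mulrCA; congr (_ * _).
  by rewrite -{2}(subnK le_i) exprD -mulrA -exprMn xy1 expr1n mulr1.
by rewrite qy0 mulr0.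
Qed.

(** The minimal polynomial of an algebraic integer has integer coefficients, by
    Gauss's lemma, and being monic it divides over [int] every integer
    polynomial that vanishes at that number. *)
Lemma integral_minPoly (L : fieldExtType rat) (x : L) :
  integralOver (intr : int -> L) x ->
  exists P : {poly int},
    [/\ P \is monic, (1 < size P <= (\dim {:L}).+1)%N &
        forall q : {poly int}, (map_poly intr q).[x] = 0 ->
          exists r : {poly int}, q = P * r].
Proof.
move=> [B mB Bx].
have /polyOver1P [p0 p0E] := minPolyOver 1%AS x.
have toL (q : {poly int}) :
    map_poly intr q = map_poly (in_alg L) (map_poly intr q).
  rewrite -map_poly_comp; apply: eq_map_poly => z /=.
  by rewrite -(rmorph_int (in_alg L)).
have p0dvd (q : {poly int}) : (map_poly intr q : {poly L}).[x] = 0 ->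
    p0 %| map_poly intr q.
  move=> qx; rewrite -(dvdp_map (in_alg L)) -p0E -toL.
  apply: minPoly_dvdp; last by apply/rootP.
  by apply/polyOver1P; exists (map_poly intr q).
have mp0 : p0 \is monic.
  by rewrite -(map_monic (in_alg L)) -p0E monic_minPoly.
have [p1 [a a0 p0a] [r BE]] := dvdpP_rat_int (p0dvd _ (rootP Bx)).
have lc1 : lead_coef p1 * lead_coef r = 1.
  by rewrite -lead_coefM -BE; apply/monicP.
pose s := lead_coef r.
(* The leading coefficient of [p1] divides that of the monic [B], so it is a
   sign, which [s] cancels. *)
have P0 : p0 = map_poly intr (s *: p1).
  have ints: s%:~R * (lead_coef p1)%:~R = 1 :> rat.
    by rewrite -rmorphM mulrC lc1.
  have : a * (lead_coef p1)%:~R = 1.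
    move/monicP: mp0; rewrite p0a lead_coefZ lead_coef_map_inj //.
    exact: intr_inj.
  move=> alc; rewrite map_polyZ /= p0a; congr (_ *: _).
  by rewrite -[a]mulr1 -{1}ints mulrCA alc mulr1.
exists (s *: p1); split.
- by apply/monicP; rewrite lead_coefZ mulrC.
- have -> : size (s *: p1) = (adjoin_degree 1%AS x).+1.
    rewrite -(size_map_inj_poly (@intr_inj rat)) // -P0.
    by rewrite -(size_map_poly (in_alg L)) -p0E size_minPoly.
  rewrite !ltnS adjoin_degreeE dimv1 divn1; apply/andP; split=> //.
  exact/dimvS/subvf.
move=> q /p0dvd /dvdpP_rat_int [p2 [b b0 p0b] [t qE]].
(* [map_poly intr p2] is proportional to the monic [p0], so [p2] is its own
   leading coefficient times the minimal polynomial. *)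
have p2P : p2 = lead_coef p2 *: (s *: p1).
  apply: (@map_inj_poly _ _ (intr : int -> rat)) => //; first exact: intr_inj.
  rewrite map_polyZ /= -P0 p0b scalerA.
  suff -> : (lead_coef p2)%:~R * b = 1 by rewrite scale1r.
  move/monicP: mp0; rewrite p0b lead_coefZ lead_coef_map_inj //; last first.
    exact: intr_inj.
  by rewrite mulrC.
exists (lead_coef p2 *: t).
by rewrite qE [in LHS]p2P -scalerAl -scalerAr.
Qed.

(** The exponent [m] is the degree of [x] over the rationals. No norm is needed
    to see that [c = d ^ m * P(u / d)] is a unit: reversing a monic equation of
    the inverse [f] gives an integer polynomial with constant term [1] that
    vanishes at [e]. Substituting [u - d X] gives a multiple of [P] whose value
    at [u / d] is [1]; thus [c] divides a power of [d], while it is prime to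
    [d]. *)
Lemma unit_congruence_bound (L : fieldExtType rat) (u d : int) (x e f : L) :
  d != 0 -> coprimez u d ->
  integralOver (intr : int -> L) x -> integralOver (intr : int -> L) f ->
  e = u%:~R - d%:~R * x -> e * f = 1 ->
  exists2 m : nat, (0 < m <= \dim {:L})%N &
    (d %| u ^+ m - 1)%Z \/ (d %| u ^+ m + 1)%Z.
Proof.
move=> d0 cud ix [T mT Tf] eE ef1.
have [P [mP /andP[sP1 sPL] Pmin]] := integral_minPoly ix.
pose W := reverse_poly T \Po (u%:P - d *: 'X).
have [S WE] : exists S, W = P * S.
  apply: Pmin; rewrite /W.
  rewrite (map_comp_poly (intr : {rmorphism int -> L})) horner_comp.
  have -> : (map_poly intr (u%:P - d *: 'X) : {poly L}).[x] = e.
    by rewrite rmorphB /= map_polyC map_polyZ /= map_polyX !hornerE eE.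
  by apply: reverse_poly_root ef1 _; apply/rootP.
pose h : rat := u%:~R / d%:~R.
have d0q : d%:~R != 0 :> rat by rewrite intr_eq0.
have PS1 : (map_poly intr P).[h] * (map_poly intr S).[h] = 1.
  rewrite -hornerM -rmorphM -WE /W /=.
  rewrite (map_comp_poly (intr : {rmorphism int -> rat})) horner_comp.
  have -> : (map_poly intr (u%:P - d *: 'X)).[h] = 0.
    rewrite rmorphB /= map_polyC map_polyZ /= map_polyX !hornerE /=.
    by rewrite /h mulrAC divff // mul1r subrr.
  rewrite horner_coef0 coef_map_id0 // -horner_coef0 reverse_poly0.
  by rewrite (monicP mT).
have cs : homog_eval u d P * homog_eval u d S
    = d ^+ ((size P).-1 + (size S).-1).
  apply: (@intr_inj rat); rewrite rmorphM rmorphXn /= !homog_evalE //.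
  by rewrite mulrACA PS1 mulr1 exprD.
set c := homog_eval u d P in cs.
have dc : (d %| c - u ^+ (size P).-1)%Z by apply: homog_eval_monic.
have cop : coprimez c (d ^+ ((size P).-1 + (size S).-1)).
  apply: coprimezXr; rewrite /coprimez -(subrK (u ^+ (size P).-1) c).
  have /dvdzP [t ->] := dc.
  rewrite gcdzC gcdzMDl -/(coprimez _ _) coprimez_sym; exact: coprimezXl.
have c1 : (c %| 1)%Z.
  rewrite -(Gauss_dvdzl 1 cop) mul1r -cs; exact: dvdz_mulr.
exists (size P).-1.
  by case: (size P) sP1 sPL => // m; rewrite !ltnS => -> ->.
have : c = 1 \/ c = - 1.
  by move: c1; rewrite dvdz1; lia.
move: dc; rewrite -rpredN => dc.
case=> cE; [left | right]; move: dc; rewrite cE.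
  by rewrite opprB.
by rewrite opprB opprK.
Qed.

(** * The matrices and their similarity *)

(** The matrix [(0 u; 0 d)]. *)
Definition class_block (u d : int) : 'M[int]_2 :=
  \matrix_(i, j) if j == 0 then 0 else if i == 0 then u else d.

(** The block [(0 u; 0 d)] completed by an identity block of size [k]. *)
Definition class_mx (u d : int) (k : nat) : 'M[int]_(2 + k) :=
  block_mx (class_block u d) 0 0 1%:M.

Lemma int_class_mx (R : comNzRingType) (u d : int) (k : nat) :
  int_mx R (class_mx u d k)
    = block_mx (int_mx R (class_block u d)) 0 0 1%:M.
Proof. by rewrite /int_mx map_block_mx !map_mx0 map_mx1. Qed.

Lemma mulmx2E (R : comNzRingType) (A B : 'M[R]_2) i j :
  (A *m B) i j = A i 0 * B 0 j + A i 1 * B 1 j.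
Proof.
have lift1 : lift ord0 ord0 = 1 :> 'I_2 by apply: val_inj.
by rewrite mxE !big_ord_recl big_ord0 addr0 lift1.
Qed.

(** The conjugating matrix is [(e x; 0 1)] on the first block, and the identity
    on the second. *)
Lemma class_mx_similar (R : comNzRingType) (u d : int) (k : nat) (x e f : R) :
  e = u%:~R - d%:~R * x -> e * f = 1 ->
  similar_over (int_mx R (class_mx 1 d k)) (int_mx R (class_mx u d k)).
Proof.
move=> eE ef1; rewrite !int_class_mx.
pose A : 'M[R]_2 := \matrix_(i, j)
  if i == 0 then (if j == 0 then e else x) else (if j == 0 then 0 else 1).
pose B : 'M[R]_2 := \matrix_(i, j)
  if i == 0 then (if j == 0 then f else - (f * x))
  else (if j == 0 then 0 else 1).
exists (block_mx A 0 0 1%:M), (block_mx B 0 0 1%:M).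
have ord2 (P : 'I_2 -> Prop) : P 0 -> P 1 -> forall i, P i.
  move=> P0 P1 [[|[|//]] i2]; [move: P0 | move: P1];
  by congr P; apply: val_inj.
have mx2 (C D : 'M[R]_2) : C 0 0 = D 0 0 -> C 0 1 = D 0 1 -> C 1 0 = D 1 0 ->
    C 1 1 = D 1 1 -> C = D.
  by move=> ? ? ? ?; apply/matrixP; apply: (ord2); apply: (ord2).
rewrite !mulmx_block !(mulmx0, mul0mx, mulmx1, mul1mx, addr0, add0r).
have fe1 : f * e = 1 by rewrite mulrC.
split.
- rewrite scalar_mx_block; congr block_mx.
  by apply: (mx2); rewrite mulmx2E !mxE /= ?mulrN ?mulrA ?ef1; ring.
- rewrite scalar_mx_block; congr block_mx.
  by apply: (mx2); rewrite mulmx2E !mxE /= ?fe1; ring.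
- congr block_mx.
  by apply: (mx2); rewrite !mulmx2E !mxE /= ?eE; ring.
Qed.

(** [1] is not an eigenvalue of [(0 u; 0 d)], so the upper right block [B] of a
    conjugating matrix vanishes. Its upper left block [A] is then invertible and
    upper triangular; its diagonal entries are units, and their quotient is the
    unit [e]. *)
Lemma class_mx_similar_inv (R : comNzRingType) (u d : int) (k : nat) :
  (forall (m : int) (y : R), m != 0 -> m%:~R * y = 0 -> y = 0) ->
  u != 0 -> d != 1 ->
  similar_over (int_mx R (class_mx 1 d k)) (int_mx R (class_mx u d k)) ->
  exists x e f : R, e = u%:~R - d%:~R * x /\ e * f = 1.
Proof.
move=> tf u0 d1; rewrite !int_class_mx => -[U [V []]].
rewrite -(submxK U) -(submxK V).
move: (ulsubmx U) (ursubmx U) (dlsubmx U) (drsubmx U) => A B C D.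
move: (ulsubmx V) (ursubmx V) (dlsubmx V) (drsubmx V) => A' B' C' D'.
rewrite !mulmx_block !(mulmx0, mul0mx, mulmx1, mul1mx, addr0, add0r).
rewrite scalar_mx_block => /eq_block_mx[UV _ _ _] _ /eq_block_mx[AM BN _ _].
have B0 : B = 0.
  have BE i j : B i j = (if i == 0 then u%:~R else d%:~R) * B 1 j.
    rewrite {1}BN mxE !big_ord_recl big_ord0 !mxE /= mulrC mulr0 add0r addr0.
    have -> : lift ord0 ord0 = 1 :> 'I_2 by apply: val_inj.
    by case: (i == 0).
  have B1 j : B 1 j = 0.
    apply: (tf (d - 1)); first by rewrite subr_eq0.
    by rewrite rmorphB /= mulrBl mul1r {2}BE /= subrr.
  by apply/matrixP => i j; rewrite BE B1 mulr0 mxE.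
rewrite B0 mul0mx addr0 in UV.
have := congr1 (fun C : 'M_2 => C 0 0) AM.
have := congr1 (fun C : 'M_2 => C 0 1) AM.
have := congr1 (fun C : 'M_2 => C 0 0) UV.
have := congr1 (fun C : 'M_2 => C 1 0) UV.
have := congr1 (fun C : 'M_2 => C 1 1) UV.
rewrite !mulmx2E !mxE /= !mulr0 !mul0r !add0r => e11 e10 e00 eM cM.
have c0 : A 1 0 = 0 by apply: (tf u).
rewrite c0 !mul0r !add0r in e11 e10.
have c0' : A' 1 0 = 0.
  have -> : A' 1 0 = A' 1 1 * (A 1 1 * A' 1 0).
    by rewrite mulrA (mulrC (A' 1 1)) e11 mul1r.
  by rewrite e10 mulr0.
rewrite c0' mulr0 addr0 in e00.
exists (A 0 1 * A' 1 1), (A 0 0 * A' 1 1), (A' 0 0 * A 1 1); split.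
  transitivity (u%:~R * (A 1 1 * A' 1 1) - d%:~R * (A 0 1 * A' 1 1)).
    rewrite mulrA -eM; ring.
  by rewrite e11 mulr1.
transitivity ((A 0 0 * A' 0 0) * (A 1 1 * A' 1 1)); first ring.
by rewrite e00 e11 mulr1.
Qed.

(** * Similarity over the p-adic integers *)

Lemma residues_natE (p m k : nat) : (m%:R : residues p) k = m%:R.
Proof. by elim: m => // m IH; rewrite !mulrS -IH. Qed.

Lemma inZp_mul (a b : nat) (x y : 'Z_a) :
  ((Zp_trunc b).+2 %| (Zp_trunc a).+2)%N ->
  inZp (x * y)%R = inZp x * inZp y :> 'Z_b.
Proof. by move=> ba; apply: val_inj; rewrite /= modn_dvdm // modnMm. Qed.

Lemma inZp_nat (a b m : nat) :
  ((Zp_trunc b).+2 %| (Zp_trunc a).+2)%N ->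
  inZp (m%:R : 'Z_a) = m%:R :> 'Z_b.
Proof. by move=> ba; rewrite !Zp_nat; apply: val_inj; rewrite /= modn_dvdm. Qed.

Lemma padic_inv (p m : nat) : prime p -> coprime p m ->
  exists x : padic_int p, m%:R * x = 1.
Proof.
move=> pp cpm.
pose y : residues p := fun k => (m%:R)^-1.
have my k : m%:R * y k = 1.
  rewrite divrr // unitZpE ?coprimeXl //.
  by rewrite (leq_trans (prime_gt1 pp)) // -{1}(expn1 p) leq_exp2l ?prime_gt1.
have cy : y \in @coherent p.
  apply/asboolP => k.
  have dk := Zp_trunc_dvd p k.
  have := my k.+1.
  move=> /(congr1 (fun z : 'Z_(p ^ k.+2) => inZp z : 'Z_(p ^ k.+1))).
  rewrite inZp_mul // inZp_nat // (inZp_nat 1) // => mz.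
  by rewrite -[LHS]mul1r -(my k) mulrAC mz mul1r.
exists (PadicInt cy); apply: val_inj; rewrite rmorphM rmorph_nat rmorph1 /=.
apply: functional_extensionality_dep => k.
by rewrite -[RHS](my k) -(residues_natE p m k).
Qed.

Lemma class_mx_similar_padic (n k p : nat) : (0 < n)%N -> prime p ->
  similar_over (int_mx (padic_int p) (class_mx 1 (2 ^ n + 1)%N k))
               (int_mx (padic_int p) (class_mx 2 (2 ^ n + 1)%N k)).
Proof.
move=> n0 pp; have [p2|p2] := eqVneq p 2%N.
  have [|x dx] := @padic_inv p (2 ^ n + 1)%N pp.
    by rewrite p2 coprime2n oddD oddX; case: n n0.
  apply: (@class_mx_similar _ _ _ _ x 1 1); last exact: mulr1.
  by rewrite -pmulrn dx; ring.
have [|x dx] := @padic_inv p 2 pp.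
  by rewrite prime_coprime // dvdn_prime2.
by apply: (@class_mx_similar _ _ _ _ 0 2 x) => //; rewrite mulr0 subr0.
Qed.

(** * Similarity over the integers of some number field *)

(** With [H(X, Y) = X ^ n + a X ^ (n - 1) Y + b Y ^ n], the equation of [x] says
    that [H(d x, d) = 0] and the hypothesis on [u] and [d] that [H(u, d) = - 1];
    [u - d x] divides the difference of these two values. *)
Lemma unit_of_root (R : comNzRingType) (u d a b : int) (n : nat) (x : R) :
  u ^+ n + d * (a * u ^+ n.-1 + b * d ^+ n.-1) = - 1 -> (0 < n)%N ->
  x ^+ n + a%:~R * x ^+ n.-1 + b%:~R = 0 ->
  exists f, (u%:~R - d%:~R * x) * f = 1.
Proof.
case: n => // n /= ud _ rx.
pose y : R := d%:~R * x.
pose v : R := u%:~R.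
have hy : y ^+ n.+1 + d%:~R * (a%:~R * y ^+ n + b%:~R * d%:~R ^+ n) = 0.
  rewrite /y !exprMn -[RHS](mulr0 (d%:~R ^+ n.+1)) -rx !exprS; ring.
have hv : v ^+ n.+1 + d%:~R * (a%:~R * v ^+ n + b%:~R * d%:~R ^+ n) = - 1.
  rewrite -[RHS](rmorphN1 (intr : {rmorphism int -> R})) -ud /=.
  by rewrite !(rmorphD, rmorphM, rmorphXn).
exists (- (\sum_(i < n.+1) v ^+ (n - i) * y ^+ i
   + d%:~R * a%:~R * \sum_(i < n) v ^+ (n.-1 - i) * y ^+ i)).
rewrite mulrN mulrDr -(subrXX v y n.+1) [(v - y) * _]mulrCA -subrXX.
rewrite -[RHS]opprK -hv -[in RHS](subr0 (_ + _)) -hy; ring.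
Qed.

Lemma exists_number_field_root (q : {poly int}) : (1 < size q)%N ->
  exists (L : fieldExtType rat) (x : L), (map_poly intr q).[x] = 0.
Proof.
move=> sq.
have /closed_rootP [z /rootP qz] : size (map_poly intr q : {poly algC}) != 1%N.
  by rewrite size_map_inj_poly ?gtn_eqF //; apply: intr_inj.
have [L [g [[|x [|? ?]] // [gx] _]]] := num_field_exists [:: z].
exists L, x; apply: (fmorph_inj g); rewrite rmorph0 -qz -gx.
rewrite -horner_map -map_poly_comp; congr (_.[_]).
by apply: eq_map_poly => t /=; rewrite (rmorph_int g).
Qed.

Lemma class_mx_similar_number_field (u d : int) (n k : nat) : (0 < n)%N ->
  coprimez u d -> (d %| u ^+ n + 1)%Z ->
  exists L : fieldExtType rat,
    similar_over (int_mx (ring_of_integers L) (class_mx 1 d k))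
                 (int_mx (ring_of_integers L) (class_mx u d k)).
Proof.
move=> n0 cud /dvdzP [t tE].
have /coprimezP [[a b] /= ab] : coprimez (u ^+ n.-1) (d ^+ n.-1).
  by apply/coprimezXl/coprimezXr.
pose q : {poly int} := 'X^n + ((- t * a) *: 'X^(n.-1) + (- t * b)%:P).
have sq : size q = n.+1.
  rewrite /q size_polyDl ?size_polyXn // ltnS.
  rewrite (leq_trans (size_polyD _ _)) // geq_max size_polyC.
  rewrite (leq_trans (size_scale_leq _ _)) ?size_polyXn ?prednK //=.
  by case: eqP.
have [|L [x qx]] := @exists_number_field_root q; first by rewrite sq.
have ix : x \in @algint L.
  apply/asboolP; exists q.
    apply/monicP; rewrite lead_coefE sq /q !coefE eqxx /= gtn_eqF ?prednK //.
    by rewrite eqn0Ngt n0 mulr0 !addr0.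
  exact/rootP.
exists L; pose y := RingOfIntegers ix.
(* [u ^ n - t * d = - 1] is the hypothesis that [unit_of_root] asks for. *)
have [||f yf] :=
  @unit_of_root (ring_of_integers L) u d (- t * a) (- t * b) n y _ n0.
- transitivity (u ^+ n - t * d * (a * u ^+ n.-1 + b * d ^+ n.-1)).
    by ring.
  by rewrite ab -tE; ring.
- apply: val_inj; rewrite [RHS]rmorph0 -[RHS]qx /q.
  rewrite [LHS]rmorphD [in LHS]rmorphD [in LHS]rmorphM !rmorphXn !rmorph_int /=.
  rewrite [in RHS]rmorphD [in RHS]rmorphD /= map_polyXn map_polyZ map_polyXn.
  by rewrite map_polyC !hornerE.
exact: class_mx_similar yf.
Qed.

(** * The minimal degree *)

Lemma ring_of_integers_torsion_free (L : fieldExtType rat) (m : int)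
    (y : ring_of_integers L) : m != 0 -> m%:~R * y = 0 -> y = 0.
Proof.
move=> m0 /(congr1 val); rewrite rmorphM rmorph_int rmorph0 => my0.
apply: val_inj; rewrite rmorph0; apply/eqP.
move/eqP: my0; rewrite mulf_eq0 => /orP[|//].
by rewrite -(rmorph_int (in_alg L)) fmorph_eq0 intr_eq0 (negPf m0).
Qed.

Lemma map_roi_ext_int_mx (K : fieldType) (L : fieldExtType K) (n : nat)
    (M : 'M[int]_n) :
  map_mx (@roi_ext K L) (int_mx (ring_of_integers K) M)
    = int_mx (ring_of_integers L) M.
Proof.
apply/matrixP => i j; rewrite !mxE; apply: val_inj.
transitivity ((\val ((M i j)%:~R : ring_of_integers K))%:A : L) => //.
by rewrite !rmorph_int; exact: (rmorph_int (in_alg L)).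
Qed.

(** Nonemptiness matters, as the minimal degree is [0] by convention when no
    extension works. *)
Lemma min_similarity_degree_geq (K : fieldType) (n e : nat)
    (M N : 'M[ring_of_integers K]_n) :
  similarity_degrees M N !=set0 ->
  (forall d, similarity_degrees M N d -> (e <= d)%N) ->
  (e <= min_similarity_degree M N)%N.
Proof.
move=> [d0 Sd0] lb.
have ex : exists d, `[< similarity_degrees M N d >] by exists d0; apply/asboolP.
have [d /asboolP Sd dmin] := ex_minnP ex.
suff [] : [set d | similarity_degrees M N d /\
    forall f, similarity_degrees M N f -> (d <= f)%N]
  (min_similarity_degree M N).
  by move=> /lb.
by apply: xgetPex; exists d; split=> // f /asboolP/dmin.
Qed.

Lemma leq_of_dvd_exp2 (m n : nat) : (0 < m)%N ->
  ((2 ^ n + 1)%N %| 2%:Z ^+ m - 1)%Z \/ ((2 ^ n + 1)%N %| 2%:Z ^+ m + 1)%Z ->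
  (n <= m)%N.
Proof.
move=> m0 dvd; rewrite leqNgt; apply/negP => mn.
have lt_pow : (2 ^ m < 2 ^ n)%N by rewrite ltn_exp2l.
have pos : (1 < 2 ^ m)%N by rewrite -{1}(expn0 2) ltn_exp2l.
have le_of (z : nat) : (0 < z)%N -> ((2 ^ n + 1)%N %| z%:Z)%Z ->
    (2 ^ n + 1 <= z)%N.
  by move=> z0 ?; apply: dvdn_leq.
case: dvd => [|].
  have -> : 2%:Z ^+ m - 1 = (2 ^ m - 1)%N :> int by lia.
  by move/le_of; lia.
have -> : 2%:Z ^+ m + 1 = (2 ^ m + 1)%N :> int by lia.
by move/le_of; lia.
Qed.

Lemma similarity_degrees_class_mx_geq (n k e : nat) : (0 < n)%N ->
  similarity_degrees
    (int_mx (ring_of_integers rat) (class_mx 1 (2 ^ n + 1)%N k))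
    (int_mx (ring_of_integers rat) (class_mx 2 (2 ^ n + 1)%N k)) e ->
  (n <= e)%N.
Proof.
move=> n0 [L [<-]]; rewrite !map_roi_ext_int_mx.
have d0 : (2 ^ n + 1)%N%:Z != 0 by lia.
have d1 : (2 ^ n + 1)%N%:Z != 1 by have := expn_gt0 2 n; lia.
move=> /(class_mx_similar_inv (@ring_of_integers_torsion_free L)) [] //.
move=> x [a [f [aE af1]]].
have cop : coprimez 2 (2 ^ n + 1)%N.
  by rewrite coprimezE /= coprime2n oddD oddX; case: n n0 {d0 d1 aE}.
have int_val (y : ring_of_integers L) : integralOver (intr : int -> L) (\val y).
  by case: y => y /= /asboolP.
have [||m /andP[m0 mL] dvd] :=
    unit_congruence_bound d0 cop (int_val x) (int_val f) (e := \val a).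
- by rewrite aE rmorphB rmorphM !rmorph_int.
- by rewrite -rmorphM af1 rmorph1.
exact: leq_trans (leq_of_dvd_exp2 m0 dvd) mL.
Qed.

Lemma similarity_degrees_class_mx_nonempty (n k : nat) : (0 < n)%N ->
  similarity_degrees
    (int_mx (ring_of_integers rat) (class_mx 1 (2 ^ n + 1)%N k))
    (int_mx (ring_of_integers rat) (class_mx 2 (2 ^ n + 1)%N k)) !=set0.
Proof.
move=> n0.
have [||L simL] := @class_mx_similar_number_field 2 (2 ^ n + 1)%N n k n0.
- by rewrite coprimezE /= coprime2n oddD oddX; case: n n0.
- suff -> : 2 ^+ n + 1 = (2 ^ n + 1)%N :> int by [].
  change (2%:Z ^+ n + 1 = (2 ^ n + 1)%N); lia.
by exists (\dim {:L}); exists L; rewrite !map_roi_ext_int_mx.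
Qed.

(** The matrices of the theorem, of size [n], for [d = 2 ^ n + 1]; sizes [0] and
    [1], too small for a block of size two, get the zero matrix. *)
Definition sized_class_mx (u : int) (n : nat) : 'M[int]_n :=
  if n is k.+2 then class_mx u (2 ^ n + 1)%N k else 0.

Theorem theorem3 :
  exists M N : forall n : nat, 'M[int]_n,
    (forall n : nat, (1 <= n)%N -> forall p : nat, prime p ->
       similar_over (int_mx (padic_int p) (M n)) (int_mx (padic_int p) (N n))) /\
    (fun n : nat => min_similarity_degree
                      (int_mx (ring_of_integers rat) (M n))
                      (int_mx (ring_of_integers rat) (N n))) @ \oo --> \oo.
Proof.
exists (sized_class_mx 1), (sized_class_mx 2); split.
  move=> [|[|k]] // _ p pp; last exact: class_mx_similar_padic.
  by exists 1%:M, 1%:M; rewrite !mulmx1 mul1mx.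
move=> A [e _ eA]; exists (maxn e 2) => // -[|[|k]] /=;
  rewrite geq_max ?andbF //.
move=> /andP[ek _]; apply: eA => /=; apply: leq_trans ek _.
apply: min_similarity_degree_geq.
  exact: similarity_degrees_class_mx_nonempty.
by move=> d; apply: similarity_degrees_class_mx_geq.
Qed.
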